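(* Let $G$ be a graph and let $I(G)$ be its edge ideal. If $H$ is an induced subgraph of $G$ with covering number $\alpha_0(H)$ and $\rho_{ic}(I(G))$ is the ic-resurgence of $I(G)$, then $$\rho_{ic}(I(G))\geq\frac{2\alpha_0(H)}{|V(H)|}.$$
   Context: Graphs are finite and simple with non-empty vertex set; $V(G)=\{t_1,\ldots,t_s\}$ and $S=K[t_1,\ldots,t_s]$ is the polynomial ring over a field $K$. The edge ideal $I(G)$ is the ideal of $S$ generated by all $t_it_j$ with $\{t_i,t_j\}$ an edge of $G$. A vertex cover of a graph is a set of vertices meeting every edge; the covering number $\alpha_0(H)$ is the number of vertices in a smallest vertex cover of $H$. For an ideal $I$ of $S$ with minimal primes $\mathfrak{p}_1,\ldots,\mathfrak{p}_r$ and $n\geq 1$, the $n$-th symbolic power is $I^{(n)}=\bigcap_{i=1}^r(I^nS_{\mathfrak{p}_i}\cap S)$. $\overline{L}$ is the integral closure of an ideal $L$. For a squarefree monomial ideal $I$, the ic-resurgence is $\rho_{ic}(I)=\sup\{m/r\mid I^{(m)}\not\subset\overline{I^r}\}$, where $m,r$ range over positive integers and the supremum is taken in $[0,\infty]$. *)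

(* Defs.v *)
From HB Require Import structures.
(* The notations of mpoly clash with those of classical_sets, and its other
   names would hide some of ssrbool's if it came last. *)
From mathcomp Require Import -(notations) mpoly.
From mathcomp Require Import all_boot all_order all_algebra.
From mathcomp Require Import ring_quotient fraction.
From mathcomp Require Import boolp classical_sets reals constructive_ereal ereal.

Set Implicit Arguments.
Unset Strict Implicit.
Unset Printing Implicit Defensive.

Import GRing.Theory.
Local Open Scope classical_set_scope.
Local Open Scope ring_scope.

Record sgraph (T : finType) := SGraph {
  edge :> rel T;
  edge_sym : symmetric edge;
  edge_irrefl : irreflexive edge }.

Section Graphs.
Context (T : finType).

Definition vertex_cover (G : sgraph T) (C : {set T}) : bool :=
  [forall u, forall v, G u v ==> (u \in C) || (v \in C)].

Definition covering_number (G : sgraph T) : nat :=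
  #|[arg min_(C < [set: T]%SET | vertex_cover G C) #|C|]|.

Lemma vertex_coverT (G : sgraph T) : vertex_cover G [set: T]%SET.
Proof. by apply/'forall_forallP => u v; rewrite !finset.inE implybT. Qed.

Variables (G : sgraph T) (W : {set T}).

Let induced_rel : rel {x | x \in W} := relpre val G.

Let induced_sym : symmetric induced_rel.
Proof. by move=> u v; exact: edge_sym. Qed.

Let induced_irrefl : irreflexive induced_rel.
Proof. by move=> u; exact: edge_irrefl. Qed.

Definition induced : sgraph {x | x \in W} := SGraph induced_sym induced_irrefl.

End Graphs.

Section Ideals.
Context (A : comNzRingType).
Implicit Types (X I L : set A).

Definition ideal_gen X : set A :=
  [set x | exists (k : nat) (c a : 'I_k -> A),
    (forall i, X (a i)) /\ x = \sum_(i < k) c i * a i].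

Definition ideal_pow I (n : nat) : set A :=
  ideal_gen [set x | exists a : 'I_n -> A,
    (forall i, I (a i)) /\ x = \prod_(i < n) a i].

(* The coefficient of z ^ (n - j) in the equation of integral dependence is to
   lie in L ^ j; here j = i + 1. *)
Definition integral_closure L : set A :=
  [set z | exists (n : nat) (a : 'I_n -> A),
    [/\ (0 < n)%N, (forall i : 'I_n, ideal_pow L i.+1 (a i)) &
        z ^+ n + \sum_(i < n) a i * z ^+ (n - i.+1) = 0]].

(* idealr_closed contains 1 \notin P. *)
Definition prime_ideal (P : set A) : Prop :=
  idealr_closed [in P] /\ prime_idealr_closed [in P].

Definition minimal_prime I (P : set A) : Prop :=
  [/\ prime_ideal P, I `<=` P &
      forall Q : set A, prime_ideal Q -> I `<=` Q -> Q `<=` P -> Q = P].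

End Ideals.

Section SymbolicPower.
Context (A : idomainType).
Implicit Types (I J P : set A).

(* The local ring A_P, as a subring of the fraction field of A. *)
Definition localization P : set {fraction A} :=
  [set x | exists a s : A, ~ P s /\ x = tofrac a / tofrac s].

(* The ideal J A_P of A_P generated by J. *)
Definition extension P J : set {fraction A} :=
  [set x | exists (k : nat) (c : 'I_k -> {fraction A}) (a : 'I_k -> A),
    [/\ (forall i, localization P (c i)), (forall i, J (a i)) &
        x = \sum_(i < k) c i * tofrac (a i)]].

Definition contraction P J : set A := @tofrac A @^-1` extension P J.

Definition symbolic_pow I (n : nat) : set A :=
  \bigcap_(P in minimal_prime I) contraction P (ideal_pow I n).

(* The supremum is taken in [0, +oo], whence the added 0: ereal_sup set0 is
   -oo. *)
Definition ic_resurgence (R : realType) I : \bar R :=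
  ereal_sup (0%E |` [set x | exists m r : nat,
    [/\ (0 < m)%N, (0 < r)%N,
        ~ (symbolic_pow I m `<=` integral_closure (ideal_pow I r)) &
        x = (m%:R / r%:R)%:E]]).

End SymbolicPower.

Definition edge_ideal (K : fieldType) (s : nat) (G : sgraph 'I_s) :
    set (mpoly s K) :=
  let t i := mpolyX K (mnm1 i) in
  ideal_gen [set x | exists i j : 'I_s, G i j /\ x = t i * t j].
Arguments edge_ideal K {s} G.

(* Main.v *)
Require Import Defs.
From HB Require Import structures.
From mathcomp Require Import -(notations) mpoly.
From mathcomp Require Import all_boot all_order all_algebra.
From mathcomp Require Import fraction ring lra zify.
From mathcomp Require Import boolp classical_sets reals constructive_ereal ereal.

Set Implicit Arguments.
Unset Strict Implicit.
Unset Printing Implicit Defensive.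

Local Open Scope ring_scope.

(** The extremal elements are the powers of f, the product of the variables t_v
    with v in W; write a for the covering number of H and h for |W|.

    Lower bound for the symbolic order. A prime P containing I(G) cuts out a
    vertex cover {v | t_v in P} of G, hence at least a of the factors t_v of f
    lie in P. If P is a minimal prime, each of them lies in the extension of
    I(G) to the localization at P: some neighbour w of v has t_w outside P
    ([minimal_prime_neighbour]; otherwise v could be removed from the cover, and
    the variables of the smaller cover would generate a smaller prime), so that
    t_v = (t_v t_w) / t_w. Therefore f lies in I(G)^(a), and f^k lies in
    I(G)^(a k) for every k.

    Upper bound for the integral order. Substituting X for every variable maps
    I(G)^r into the multiples of X^(2r) and f^k to X^(h k). The X-adic valuation
    is compatible with equations of integral dependence
    ([integral_closure_Xadic]), hence f^k is outside the integral closure of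
    I(G)^r as soon as h k < 2 r.

    With k = 2n and r = h n + 1 this gives the ratios 2 a n / (h n + 1), all
    bounded by the ic-resurgence and tending to 2 a / h ([ratio_limit]). *)

Import Order.TTheory GRing.Theory Num.Theory.
Local Open Scope classical_set_scope.
Local Open Scope ring_scope.

(** * Ideals and their powers *)

Section Ideals.
Context (A : comNzRingType).
Implicit Types (X I J P : set A).

Definition is_ideal J : Prop :=
  [/\ J 0, (forall x y, J x -> J y -> J (x + y)) &
      (forall a x, J x -> J (a * x))].

Lemma prime_ideal_is_ideal P : prime_ideal P -> is_ideal P.
Proof.
case=> -[P0 _ PD] _; have P0' : P 0 by move: P0; rewrite inE.
split=> // [x y Px Py|a x Px].
  by have := PD 1 x y (mem_set Px) (mem_set Py); rewrite mul1r inE.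
by have := PD a x 0 (mem_set Px) (mem_set P0'); rewrite addr0 inE.
Qed.

Lemma prime_ideal1 P : prime_ideal P -> ~ P 1.
Proof. by case=> -[_ P1 _] _ P1'; move: P1; rewrite mem_set. Qed.

Lemma prime_idealM P x y : prime_ideal P -> ~ P x -> ~ P y -> ~ P (x * y).
Proof.
case=> _ PM Px Py Pxy; have /orP[] := PM x y (mem_set Pxy); by rewrite inE.
Qed.

Lemma is_ideal_sum J k (F : 'I_k -> A) :
  is_ideal J -> (forall i, J (F i)) -> J (\sum_(i < k) F i).
Proof. by case=> J0 JD _ JF; apply: big_ind. Qed.

Lemma ideal_gen_ideal X : is_ideal (ideal_gen X).
Proof.
split=> [|x y [k [c [a [Xa ->]]]] [l [d [b [Xb ->]]]]|e x [k [c [a [Xa ->]]]]].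
- by exists 0%N, (fun=> 0), (fun=> 0); split=> [[]//|]; rewrite big_ord0.
- exists (k + l)%N,
    (fun i => match split i with inl i' => c i' | inr j => d j end),
    (fun i => match split i with inl i' => a i' | inr j => b j end).
  split=> [i|]; first by case: (split i).
  rewrite big_split_ord; congr (_ + _); apply: eq_bigr => i _.
    by rewrite (unsplitK (inl i)).
  by rewrite (unsplitK (inr i)).
- exists k, (fun i => e * c i), a; split=> //.
  by rewrite mulr_sumr; apply: eq_bigr => i _; rewrite mulrA.
Qed.

Lemma sub_ideal_gen X : X `<=` ideal_gen X.
Proof.
move=> x Xx; exists 1%N, (fun=> 1), (fun=> x).
by split=> //; rewrite big_ord1 mul1r.
Qed.

Lemma ideal_gen_min X J : is_ideal J -> X `<=` J -> ideal_gen X `<=` J.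
Proof.
move=> Ji XJ _ [k [c [a [Xa ->]]]]; apply: is_ideal_sum => // i.
by case: Ji => _ _ JM; apply/JM/XJ.
Qed.

Lemma ideal_pow_ideal I n : is_ideal (ideal_pow I n).
Proof. exact: ideal_gen_ideal. Qed.

Lemma ideal_pow0 I x : ideal_pow I 0 x.
Proof.
case: (ideal_pow_ideal I 0) => _ _ JM; rewrite -[x]mulr1; apply/JM.
apply: sub_ideal_gen; exists (fun=> 0); split=> [[]//|].
by rewrite big_ord0.
Qed.

Lemma ideal_pow1 I x : I x -> ideal_pow I 1 x.
Proof.
by move=> Ix; apply: sub_ideal_gen; exists (fun=> x); rewrite big_ord1.
Qed.

Lemma ideal_powM I m n x y :
  ideal_pow I m x -> ideal_pow I n y -> ideal_pow I (m + n) (x * y).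
Proof.
have [I0 ID IM] := ideal_pow_ideal I (m + n) => Imx; move: x Imx y.
apply: ideal_gen_min => [|_ [a [Ia ->]]].
  split=> [y _|x x' Ix Ix' y Iy|c x Ix y Iy]; first by rewrite mul0r.
    by rewrite mulrDl; apply: ID; [apply: Ix|apply: Ix'].
  by rewrite -mulrA; apply/IM/Ix.
apply: ideal_gen_min => [|_ [b [Ib ->]]].
  split=> [|y y' Iy Iy'|c y Iy]; first by rewrite mulr0.
    by rewrite mulrDr; apply: ID.
  by rewrite mulrCA; apply: IM.
apply: sub_ideal_gen.
exists (fun i => match split i with inl i' => a i' | inr j => b j end).
split=> [i|]; first by case: (split i).
rewrite big_split_ord; congr (_ * _); apply: eq_bigr => i _.
  by rewrite (unsplitK (inl i)).
by rewrite (unsplitK (inr i)).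
Qed.

Lemma ideal_pow_antitone I m n :
  (n <= m)%N -> ideal_pow I m `<=` ideal_pow I n.
Proof.
move=> /subnK <-; apply: ideal_gen_min; first exact: ideal_pow_ideal.
move=> _ [a [Ia ->]]; rewrite big_split_ord.
case: (ideal_pow_ideal I n) => _ _ IM; apply/IM/sub_ideal_gen.
by exists (fun i => a (rshift _ i)).
Qed.

End Ideals.

(** * Membership in a symbolic power *)

(** The numerators of an ideal of fractions: [local_pow P I n x] is a
    denominator-free form of the membership of x in the extension of I ^ n to
    the localization at the prime P. *)
Definition local_pow (A : comNzRingType) (P I : set A) (n : nat) (x : A) :=
  exists2 s : A, ~ P s & ideal_pow I n (s * x).

Section LocalPow.
Context (A : comNzRingType) (P I : set A).
Hypothesis Pprime : prime_ideal P.

Lemma local_pow0 x : local_pow P I 0 x.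
Proof. by exists 1; [exact: prime_ideal1|exact: ideal_pow0]. Qed.

Lemma local_powM m n x y :
  local_pow P I m x -> local_pow P I n y -> local_pow P I (m + n) (x * y).
Proof.
move=> [s Ps Isx] [t Pt Ity]; exists (s * t); first exact: prime_idealM.
by rewrite mulrACA; apply: ideal_powM.
Qed.

Lemma local_pow_prod (T : finType) (F : T -> nat) (x : T -> A) :
  (forall v, local_pow P I (F v) (x v)) ->
  local_pow P I (\sum_v F v) (\prod_v x v).
Proof.
move=> Ix; apply: (big_ind2 (local_pow P I)) => //; first exact: local_pow0.
by move=> m y n z; apply: local_powM.
Qed.

Lemma local_powX n x k : local_pow P I n x -> local_pow P I (n * k) (x ^+ k).
Proof.
move=> Ix; elim: k => [|k IHk]; first by rewrite muln0; apply: local_pow0.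
by rewrite mulnS exprS; apply: local_powM.
Qed.

Lemma local_pow_antitone m n x :
  (n <= m)%N -> local_pow P I m x -> local_pow P I n x.
Proof. by move=> nm [s Ps /(ideal_pow_antitone nm) Isx]; exists s. Qed.

End LocalPow.

Lemma contraction_local_pow (A : idomainType) (P I : set A) n x :
  prime_ideal P -> local_pow P I n x -> contraction P (ideal_pow I n) x.
Proof.
move=> Pprime [s Ps Isx].
exists 1%N, (fun=> tofrac 1 / tofrac s), (fun=> s * x).
split=> //; first by move=> _; exists 1, s.
have s0 : tofrac s != 0.
  rewrite tofrac_eq0; apply/eqP => s0; apply: Ps; rewrite s0.
  by case: (prime_ideal_is_ideal Pprime).
by rewrite big_ord1 tofrac1 mul1r tofracM mulrA mulVf // mul1r.
Qed.

(** * Non-membership in an integral closure *)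

Section Xadic.
Context (K : fieldType) (A : comNzRingType) (phi : {rmorphism A -> {poly K}}).
Implicit Types (I L : set A).

Lemma Xadic_ideal d : is_ideal [set x | 'X^d %| phi x]%R.
Proof.
split=> [|x y|a x] /=; first by rewrite rmorph0 dvdp0.
  by rewrite rmorphD; apply: dvdp_add.
by rewrite rmorphM; apply: dvdp_mull.
Qed.

Lemma ideal_pow_Xadic I d n :
  (forall x, I x -> 'X^d %| phi x) ->
  forall x, ideal_pow I n x -> 'X^(d * n) %| phi x.
Proof.
move=> Id; apply: ideal_gen_min; first exact: Xadic_ideal.
move=> _ [a [Ia ->]] /=; rewrite rmorph_prod exprM.
have -> : ('X^d ^+ n : {poly K}) = \prod_(i < n) 'X^d.
  by rewrite prodr_const card_ord.
by elim/big_ind2: _ => // [p q p' q'|i _]; [apply: dvdp_mul|apply: Id].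
Qed.

(** If the valuation e of z were less than d, then in the equation of integral
    dependence z ^+ n would have valuation e * n, and every other term a larger
    one. *)
Lemma integral_closure_Xadic L d z e :
  (forall x, L x -> 'X^d %| phi x) ->
  integral_closure L z -> phi z = 'X^e -> (d <= e)%N.
Proof.
move=> Ld [n [a [n0 La eqz]]] phiz; rewrite leqNgt; apply/negP => ed.
have : 'X^((e * n).+1) %| ('X^(e * n) : {poly K}).
  have -> : 'X^(e * n) = - \sum_(i < n) phi (a i * z ^+ (n - i.+1)).
    apply/eqP; rewrite -addr_eq0 exprM -phiz -rmorphXn -rmorph_sum -rmorphD.
    by rewrite eqz rmorph0.
  rewrite dvdpNr; elim/big_ind: _ => [|p q|i _]; first exact: dvdp0.
    exact: dvdp_add.
  rewrite rmorphM rmorphXn phiz -exprM.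
  have ai : 'X^(d * i.+1) %| phi (a i) by apply: (ideal_pow_Xadic Ld); apply: La.
  apply: dvdp_trans (dvdp_mul ai (dvdpp _)); rewrite -exprD dvdp_exp2l //.
  have := ltn_ord i; nia.
by rewrite dvdp_Pexp2l ?size_polyX // ltnn.
Qed.

End Xadic.

(** * Primes containing an edge ideal *)

Lemma mpoly_closure_ind (K : comNzRingType) s (Q : mpoly s K -> Prop) :
  (forall c, Q (mpolyC s c)) -> (forall i, Q (mpolyX K (mnm1 i))) ->
  (forall p q, Q p -> Q q -> Q (p + q)) ->
  (forall p q, Q p -> Q q -> Q (p * q)) -> forall p, Q p.
Proof.
move=> QC QX QD QM p; rewrite (mpolyE p).
have Q1 : Q 1 by have := QC 1; rewrite mpolyC1.
apply: big_ind => [||m _]; [by have := QC 0; rewrite mpolyC0|exact: QD|].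
rewrite -mul_mpolyC; apply: (QM) => //; rewrite mpolyXE_id.
apply: big_ind => // i _.
by elim: (m i) => [|k IHk]; rewrite ?expr0 // exprS; apply: (QM).
Qed.

Section EdgeIdeal.
Context (K : fieldType) (s : nat) (G : sgraph 'I_s).
Local Notation t i := (mpolyX K (mnm1 i) : mpoly s K).

Lemma edge_ideal_edge i j : G i j -> edge_ideal K G (t i * t j).
Proof. by move=> Gij; apply: sub_ideal_gen; exists i, j. Qed.

Section VariablePrime.
Variable C : {set 'I_s}.

Definition kill_vars : {rmorphism mpoly s K -> mpoly s K} :=
  mmap (@mpolyC s K) (fun i => if i \in C then 0 else t i).

Lemma kill_varsX i : kill_vars (t i) = if i \in C then 0 else t i.
Proof. by rewrite /kill_vars /= mmapX mmap1U. Qed.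

(** As a kernel, the ideal generated by the t_i with i in C is visibly prime. *)
Definition var_prime : set (mpoly s K) := [set p | kill_vars p = 0].

Lemma var_prime_prime : prime_ideal var_prime.
Proof.
split=> [|u v /set_mem]; last first.
  move/eqP; rewrite rmorphM mulf_eq0.
  by case/orP => /eqP uv0; apply/orP; [left|right]; apply/mem_set.
split; first by apply/mem_set; rewrite /var_prime /mkset rmorph0.
  apply/negP => /set_mem; rewrite /var_prime /mkset rmorph1.
  by move/eqP; rewrite oner_eq0.
move=> a u v /set_mem; rewrite {1}/var_prime /mkset => u0.
move=> /set_mem; rewrite {1}/var_prime /mkset => v0.
by apply/mem_set; rewrite /var_prime /mkset rmorphD rmorphM u0 v0 mulr0 addr0.
Qed.

(** Killing the variables in C does not change a polynomial modulo them. *)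
Lemma var_prime_min (P : set (mpoly s K)) :
  is_ideal P -> (forall i, i \in C -> P (t i)) -> var_prime `<=` P.
Proof.
case=> P0 PD PM PC.
suff Pdiff p : P (p - kill_vars p).
  by move=> p p0; have := Pdiff p; rewrite p0 subr0.
elim/mpoly_closure_ind: p => [c|i|p q Pp Pq|p q Pp Pq].
- by rewrite /kill_vars /= mmapC subrr.
- by rewrite kill_varsX; case: ifP => iC; rewrite ?subrr // subr0; apply: PC.
- by rewrite rmorphD opprD addrACA; apply: PD.
- rewrite rmorphM.
  have -> : p * q - kill_vars p * kill_vars q
            = p * (q - kill_vars q) + kill_vars q * (p - kill_vars p) by ring.
  by apply: PD; apply: PM.
Qed.

End VariablePrime.

(** Otherwise the variables in P other than t_i would still cover all edges, and
    generate a prime containing the edge ideal and strictly inside P. *)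
Lemma minimal_prime_neighbour (P : set (mpoly s K)) i :
  minimal_prime (edge_ideal K G) P -> P (t i) -> exists2 j, G i j & ~ P (t j).
Proof.
move=> [Pp IP Pmin] Pi; apply: contrapT => noj.
have nbr j : G i j -> P (t j).
  by move=> Gij; apply: contrapT => Pj; apply: noj; exists j.
pose C : {set 'I_s} := [set j | `[< P (t j) >] & j != i]%SET.
have cover j k : G j k -> (j \in C) || (k \in C).
  move=> Gjk; rewrite !finset.inE.
  have kj : k != j by apply/eqP => kj; rewrite kj edge_irrefl in Gjk.
  have [ji|ji] := eqVneq j i.
    by rewrite ji in Gjk kj; rewrite (asboolT (nbr _ Gjk)) kj orbT.
  have [ki|ki] := eqVneq k i.
    by rewrite edge_sym ki in Gjk; rewrite (asboolT (nbr _ Gjk)).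
  rewrite !andbT; apply/orP; apply: contrapT => PjPk.
  have [||] := prime_idealM Pp (x := t j) (y := t k).
  - by move=> Pj; apply: PjPk; left; apply/asboolP.
  - by move=> Pk; apply: PjPk; right; apply/asboolP.
  - by apply/IP/edge_ideal_edge.
have QP : var_prime C = P.
  apply: Pmin; first exact: var_prime_prime.
    apply: ideal_gen_min.
      exact/prime_ideal_is_ideal/var_prime_prime.
    move=> _ [j [k [Gjk ->]]]; rewrite /var_prime /= rmorphM !kill_varsX.
    by case/orP: (cover _ _ Gjk) => ->; rewrite ?mul0r ?mulr0.
  apply: var_prime_min; first exact: prime_ideal_is_ideal.
  by move=> j; rewrite finset.inE => /andP[/asboolP].
have : var_prime C (t i) by rewrite QP.
rewrite /var_prime /= kill_varsX finset.inE eqxx andbF => /eqP.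
by apply/negP; rewrite -msupp_eq0 msuppX.
Qed.

Lemma edge_ideal_local (P : set (mpoly s K)) i :
  minimal_prime (edge_ideal K G) P -> P (t i) ->
  local_pow P (edge_ideal K G) 1 (t i).
Proof.
move=> Pm /(minimal_prime_neighbour Pm)[j Gij Pj]; exists (t j) => //.
by apply/ideal_pow1; rewrite mulrC; apply: edge_ideal_edge.
Qed.

(** * The product of the variables of an induced subgraph *)

Section Subgraph.
Variable W : {set 'I_s}.
Local Notation V := {x | x \in W}.
Local Notation alpha := (covering_number (induced G W)).

Definition subgraph_monomial : mpoly s K := \prod_(v : V) t (val v).

Lemma covering_number_le (C : {set V}) :
  vertex_cover (induced G W) C -> (alpha <= #|C|)%N.
Proof.
rewrite /covering_number; case: arg_minnP; first exact: vertex_coverT.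
by move=> D _; apply.
Qed.

Lemma covering_number_prime (P : set (mpoly s K)) :
  prime_ideal P -> edge_ideal K G `<=` P ->
  (alpha <= \sum_(v : V) `[< P (t (val v)) >])%N.
Proof.
move=> Pp IP; pose C : {set V} := [set v | `[< P (t (val v)) >]]%SET.
have -> : (\sum_(v : V) `[< P (t (val v)) >])%N = #|C|.
  rewrite -sum1_card [RHS]big_mkcond; apply: eq_bigr => v _.
  by rewrite finset.inE; case: asbool.
apply: covering_number_le; apply/'forall_forallP => u v; apply/implyP => Guv.
rewrite !finset.inE; apply/orP; apply: contrapT => PuPv.
have [||] := prime_idealM Pp (x := t (val u)) (y := t (val v)).
- by move=> Pu; apply: PuPv; left; apply/asboolP.
- by move=> Pv; apply: PuPv; right; apply/asboolP.
- by apply/IP/edge_ideal_edge.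
Qed.

Lemma subgraph_monomial_symbolic k :
  symbolic_pow (edge_ideal K G) (alpha * k) (subgraph_monomial ^+ k).
Proof.
move=> P Pm; have [Pp IP _] := Pm.
apply: contraction_local_pow => //; apply: local_powX => //.
apply: local_pow_antitone (covering_number_prime Pp IP) _.
apply: local_pow_prod => // v; case: asboolP => Pv.
  exact: edge_ideal_local.
exact: local_pow0.
Qed.

Definition subst_X : {rmorphism mpoly s K -> {poly K}} :=
  mmap (@polyC K) (fun=> 'X).

Lemma subst_XX i : subst_X (t i) = 'X.
Proof. by rewrite /subst_X /= mmapX mmap1U. Qed.

Lemma subgraph_monomial_not_integral k r :
  (#|{: V}| * k < 2 * r)%N ->
  ~ integral_closure (ideal_pow (edge_ideal K G) r) (subgraph_monomial ^+ k).
Proof.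
move=> kr fk.
have Ir x : ideal_pow (edge_ideal K G) r x -> 'X^(2 * r) %| subst_X x.
  apply: ideal_pow_Xadic; apply: ideal_gen_min; first exact: Xadic_ideal.
  by move=> _ [i [j [_ ->]]] /=; rewrite rmorphM /= !subst_XX -expr2.
have fX : subst_X (subgraph_monomial ^+ k) = 'X^(#|{: V}| * k).
  rewrite rmorphXn rmorph_prod exprM; congr (_ ^+ k).
  by under eq_bigr do rewrite subst_XX; rewrite prodr_const.
by have := integral_closure_Xadic Ir fk fX; rewrite leqNgt kr.
Qed.

End Subgraph.
End EdgeIdeal.

(** * Passage to the limit *)

(** A positive gap between S and the limit 2 a / h contradicts the hypothesis,
    which reads n * (2 a - S h) <= S, for n large. *)
Lemma ratio_limit (R : realType) (a h : nat) (S : R) :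
  (0 < h)%N -> 0 <= S ->
  (forall n, (0 < n)%N -> (a * (2 * n))%:R / (h * n).+1%:R <= S) ->
  (2 * a)%:R / h%:R <= S.
Proof.
move=> h0 S0 bound; have h0' : 0 < h%:R :> R by rewrite ltr0n.
rewrite ler_pdivrMr // leNgt; apply/negP => gap.
set d := (2 * a)%:R - S * h%:R; have d0 : 0 < d by rewrite subr_gt0.
have := archi_boundP (divr_ge0 S0 (ltW d0)).
set n := Num.Def.archi_bound _; rewrite ltr_pdivrMr // => Snd.
have n0 : (0 < n)%N.
  by rewrite lt0n; apply: contraTneq Snd => ->; rewrite mul0r -leNgt.
have := bound n n0; rewrite ler_pdivrMr ?ltr0n //.
by move: Snd; rewrite /d -(addn1 (h * n)) !natrD !natrM; lra.
Qed.

Theorem proposition6p3 (R : realType) (K : fieldType) (s : nat) (hs : (0 < s)%N)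
  (G : sgraph 'I_s) (W : {set 'I_s}) (hW : W != finset.set0) :
  (((2 * covering_number (induced G W))%N%:R / #|{: {x | x \in W}}|%:R : R)%:E
     <= ic_resurgence R (edge_ideal K G))%E.
Proof.
set a := covering_number _; set h := #|_|.
have h0 : (0 < h)%N.
  by case/set0Pn: hW => v vW; apply/card_gt0P; exists (exist _ v vW).
have rho0 : (0 <= ic_resurgence R (edge_ideal K G))%E.
  by apply: ereal_sup_ubound; left.
have [a0|a0] := posnP a; first by rewrite a0 muln0 mul0r.
have bound n : (0 < n)%N ->
    (((a * (2 * n))%:R / (h * n).+1%:R : R)%:E
       <= ic_resurgence R (edge_ideal K G))%E.
  move=> n0; apply: ereal_sup_ubound; right.
  exists (a * (2 * n))%N, (h * n).+1; split=> //; first by rewrite !muln_gt0 a0.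
  move/(_ _ (subgraph_monomial_symbolic W (2 * n))).
  by apply: subgraph_monomial_not_integral; rewrite -/h; lia.
move: rho0 bound; case: (ic_resurgence _ _) => [S| |] // S0 bound.
  by rewrite lee_fin; apply: ratio_limit => // n /bound.
by rewrite leey.
Qed.
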